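(* Let $R$ be a Gorenstein fiber product ring. Let $M$ and $N$ be nonzero finitely generated $R$-modules such that $N$ is a rigid-test module. If $\operatorname{Ext}^i_R(M,N)=0$ for some $i>1$, then $\operatorname{pd}_R M\le 1$.
   Context: All local rings are commutative and Noetherian, and all modules are finitely generated; $\operatorname{pd}$ denotes projective dimension. A local ring $(R,\mathfrak m,k)$ is a fiber product ring if $R\cong S\times_k T=\{(s,t)\in S\times T : \pi_S(s)=\pi_T(t)\}$, where $S,T$ are local rings with the same residue field $k$, neither of them equal to $k$, and $\pi_S,\pi_T$ are the reductions modulo the maximal ideals. Equivalently, $\mathfrak m=I\oplus J$ for nonzero ideals $I,J$ of $R$. An $R$-module $N$ is a rigid-test module if for all $R$-modules $Z$: $\operatorname{Tor}^R_j(Z,N)=0$ for some $j\ge 1$ implies $\operatorname{Tor}^R_{j+1}(Z,N)=0$ and $\operatorname{pd}_R Z<\infty$. *)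

(* Defs.v *)
From HB Require Import structures.
From mathcomp Require Import all_boot all_order all_algebra.
From mathcomp Require Import boolp classical_sets.

Set Implicit Arguments.
Unset Strict Implicit.
Unset Printing Implicit Defensive.

Import GRing.Theory.
Local Open Scope classical_set_scope.
Local Open Scope ring_scope.

Section Modules.
Variable R : comNzRingType.
Implicit Types A B M N P Z T W : lmodType R.

Definition zero_module M := forall x : M, x = 0.

Definition lin_span M n (a : 'I_n -> M) : set M :=
  [set x | exists c : 'I_n -> R, x = \sum_(i < n) c i *: a i].

Definition finitely_generated M :=
  exists (n : nat) (a : 'I_n -> M), lin_span a = setT.

Definition exact (A B C : lmodType R) (f : {linear A -> B}) (g : {linear B -> C}) :=
  range f = [set y | g y = 0].

Definition projective_module P :=
  forall A B (f : {linear A -> B}) (g : {linear P -> B}),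
    range f = setT -> exists h : {linear P -> A}, f \o h =1 g.

Definition injective_module P :=
  forall A B (f : {linear A -> B}) (g : {linear A -> P}),
    injective f -> exists h : {linear B -> P}, h \o f =1 g.

(* ... -> P_2 -> P_1 -> P_0 -> M -> 0, with [pr_d n : P_{n+1} -> P_n]. *)
Record proj_resolution M := ProjResolution {
  pr_mod :> nat -> lmodType R;
  pr_d : forall n, {linear pr_mod n.+1 -> pr_mod n};
  pr_aug : {linear pr_mod 0%N -> M};
  pr_proj : forall n, projective_module (pr_mod n);
  pr_aug_surj : range pr_aug = setT;
  pr_aug_exact : exact (pr_d 0%N) pr_aug;
  pr_exact : forall n, exact (pr_d n.+1) (pr_d n)
}.

(* 0 -> M -> I_0 -> I_1 -> I_2 -> ..., with [ir_d n : I_n -> I_{n+1}]. *)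
Record inj_resolution M := InjResolution {
  ir_mod :> nat -> lmodType R;
  ir_d : forall n, {linear ir_mod n -> ir_mod n.+1};
  ir_aug : {linear M -> ir_mod 0%N};
  ir_inj : forall n, injective_module (ir_mod n);
  ir_aug_inj : injective ir_aug;
  ir_aug_exact : exact ir_aug (ir_d 0%N);
  ir_exact : forall n, exact (ir_d n) (ir_d n.+1)
}.

(* The zero module satisfies [pd_le M n] for every n (its projective
   dimension being -oo). *)
Definition pd_le M (n : nat) :=
  exists P : proj_resolution M, forall k, (n < k)%N -> zero_module (P k).

Definition id_le M (n : nat) :=
  exists I : inj_resolution M, forall k, (n < k)%N -> zero_module (I k).

(* Ext^i(M, N) = 0: the complex Hom(P, N) has no cohomology in degree i.
   Ext and Tor do not depend on the resolution up to isomorphism, so it is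
   immaterial that their vanishing is stated for some resolution rather than
   for all of them. *)
Definition Ext_zero (i : nat) M N :=
  exists P : proj_resolution M,
    match i with
    | 0%N =>
        forall phi : {linear P 0%N -> N},
          (forall x, phi (pr_d P 0%N x) = 0) -> forall x, phi x = 0
    | j.+1 =>
        forall phi : {linear P j.+1 -> N},
          (forall x, phi (pr_d P j.+1 x) = 0) ->
          exists psi : {linear P j -> N}, phi =1 psi \o pr_d P j
    end.

(* Universal property of T = A (x) B with (a, b) |-> a (x) b given by beta. *)
Definition is_tensor A B T (beta : {bilinear A -> B -> T}) :=
  forall W (phi : {bilinear A -> B -> W}),
    exists h : {linear T -> W}, (forall a b, h (beta a b) = phi a b) /\
      forall h' : {linear T -> W},
        (forall a b, h' (beta a b) = phi a b) -> h' =1 h.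

(* Tor_j(Z, N) = 0: the complex P (x) N has no homology in degree j, where P is
   a projective resolution of Z; [Q n] is P_n (x) N and [d n] is the map
   induced by the differential of P. *)
Definition Tor_zero (j : nat) Z N :=
  exists (P : proj_resolution Z) (Q : nat -> lmodType R)
         (beta : forall n, {bilinear P n -> N -> Q n})
         (d : forall n, {linear Q n.+1 -> Q n}),
    [/\ forall n, is_tensor (beta n),
        forall n x y, d n (beta n.+1 x y) = beta n (pr_d P n x) y &
        match j with
        | 0%N => range (d 0%N) = setT
        | j'.+1 => exact (d j'.+1) (d j')
        end].

Definition rigid_test N :=
  finitely_generated N /\
  forall Z, finitely_generated Z -> forall j, (1 <= j)%N ->
    Tor_zero j Z N -> Tor_zero j.+1 Z N /\ exists n, pd_le Z n.

End Modules.

Section LocalRings.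
Variable R : comNzRingType.

Definition ideal (I : set R) :=
  [/\ I 0, forall x y, I x -> I y -> I (x + y) & forall a x, I x -> I (a * x)].

Definition noetherian :=
  forall I, ideal I ->
    exists (n : nat) (a : 'I_n -> R), I = lin_span (a : 'I_n -> R^o).

Definition maximal_ideal (I : set R) :=
  [/\ ideal I, ~ I 1 & forall J, ideal J -> ~ J 1 -> I `<=` J -> J = I].

Definition local_ring := noetherian /\ exists! m : set R, maximal_ideal m.

Definition gorenstein := local_ring /\ exists n, id_le (R^o : lmodType R) n.

End LocalRings.

Section FiberProduct.
Variables (S T k : comNzRingType).
Variables (piS : {rmorphism S -> k}) (piT : {rmorphism T -> k}).

Definition fiber_pred : pred (S * T) := fun x => piS x.1 == piT x.2.

Lemma fiber_pred_subring : subring_closed fiber_pred.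
Proof.
split=> [|x y|x y]; rewrite !unfold_in /fiber_pred /=.
- by rewrite !rmorph1.
- by rewrite !rmorphB => /eqP-> /eqP->.
- by rewrite !rmorphM => /eqP-> /eqP->.
Qed.

HB.instance Definition _ :=
  GRing.isSubringClosed.Build (S * T)%type fiber_pred fiber_pred_subring.

Record fiber_product := FiberProduct {
  fp_val :> S * T;
  fp_valP : fiber_pred fp_val
}.

HB.instance Definition _ := [isSub for fp_val].
HB.instance Definition _ := [Choice of fiber_product by <:].
HB.instance Definition _ := [SubChoice_isSubComNzRing of fiber_product by <:].

End FiberProduct.

(* As k is a field, the kernels of the surjections piS and piT are the maximal
   ideals of the local rings S and T, so that piS and piT identify both residue
   fields with k; S <> k and T <> k mean that they are not isomorphisms. *)
Definition fiber_product_ring (R : comNzRingType) :=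
  local_ring R /\
  exists (S T : comNzRingType) (k : fieldType)
         (piS : {rmorphism S -> k}) (piT : {rmorphism T -> k}),
    [/\ local_ring S /\ local_ring T,
        range piS = setT /\ range piT = setT,
        ~ injective piS /\ ~ injective piT &
        exists f : {rmorphism R -> fiber_product piS piT}, bijective f].

(* Main.v *)
Require Import Defs.
From HB Require Import structures.
From mathcomp Require Import all_boot all_order all_algebra.
From mathcomp Require Import boolp classical_sets.

Set Implicit Arguments.
Unset Strict Implicit.
Unset Printing Implicit Defensive.

Import GRing.Theory.
Local Open Scope classical_set_scope.
Local Open Scope ring_scope.

(** Let the maximal ideal of [R] be I + J with I, J nonzero and I J = 0.

    A module of finite projective dimension over [R] has projective dimension at
    most 1. Otherwise its minimal free resolution ends with an exact sequence
    0 -> R^p -A-> R^q -B-> R^r where p > 0 and [A] has entries in I + J. Write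
    [A = A_I + A_J] entrywise. Since [A B = 0] and the sum I + J is direct,
    [A_I B = 0], so [A_I = U A] by exactness. If [z] is a nonzero element of J,
    then [z U A = z A_I = 0], so [z U = 0] and the entries of [U] are not units;
    if [y] is a nonzero element of I, then [y (1 - U) A = y A_J = 0], so
    [y (1 - U) = 0], although the diagonal entries of [1 - U] are units. This
    contradiction is [injective_syzygy_rank0]; the passage from an arbitrary
    finite projective resolution to the minimal one is [pd_le_contraction],
    which rests on the homotopy equivalence of projective resolutions.

    Now let [D] be the differentials of the minimal free resolution F of [M],
    suppose Ext^i(M, N) = 0 with i = j + 1, and let [d] be the transpose of
    [D j.+1]. The kernel of [d] (x) [N] is the image of the transpose of [D j]
    tensored with [N]. As that transpose composes with [d] to 0, this gives
    Tor_1(coker d, N) = 0, so the rigid-test property of [N] makes the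
    projective dimension of coker d finite, hence at most 1. Thus the image of
    [d] is free, and the kernel of [d] is the row space of an idempotent matrix
    [e]. For every [y] in [N] the vectors [e_a] (x) [y] are cycles, hence
    boundaries, and so have entries in m N by minimality of F; as m N <> N, the
    entries of [e] lie in m, and [e = 0] by Nakayama's lemma. So [d] is
    injective, which forces [D j = 0]: by minimality F vanishes in degree j + 1
    and [M] has finite projective dimension, hence at most 1. *)

(** * Kernels, cokernels and comparison of resolutions *)

Section Kernel.
Variables (R : comNzRingType) (B C : lmodType R) (g : {linear B -> C}).

Definition ker_pred : pred B := fun x => g x == 0.

Lemma ker_pred_submod : submod_closed ker_pred.
Proof.
split=> [|a x y]; rewrite !unfold_in /ker_pred ?linear0 //.
by rewrite linearP => /eqP-> /eqP->; rewrite scaler0 addr0.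
Qed.

HB.instance Definition _ :=
  GRing.isSubmodClosed.Build R B ker_pred ker_pred_submod.

(** The kernel of [g] as a module. *)
Record ker_type := KerType { ker_val :> B; ker_valP : ker_pred ker_val }.

HB.instance Definition _ := [isSub for ker_val].
HB.instance Definition _ := [Choice of ker_type by <:].
HB.instance Definition _ := [SubChoice_isSubLmodule of ker_type by <:].

End Kernel.

Section Corestriction.
Variables (R : comNzRingType) (A B C : lmodType R).
Variables (f : {linear A -> B}) (g : {linear B -> C}).
Hypothesis gf0 : forall x, g (f x) = 0.

Definition to_ker (x : A) : ker_type g := KerType (introT eqP (gf0 x)).

Lemma to_ker_linear : linear to_ker.
Proof. by move=> a x y; apply: val_inj; rewrite /= linearP. Qed.

HB.instance Definition _ :=
  GRing.isLinear.Build R A (ker_type g) *:%R to_ker to_ker_linear.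

End Corestriction.

Section Modules.
Variable R : comNzRingType.

(** A map from a projective module into the cycles of an exact sequence lifts
    to the term before. *)
Lemma projective_lift (P A B C : lmodType R) (f : {linear A -> B})
    (g : {linear B -> C}) (u : {linear P -> B}) :
  projective_module P -> exact f g -> (forall x, g (u x) = 0) ->
  exists h : {linear P -> A}, forall x, f (h x) = u x.
Proof.
move=> projP exfg gu0.
have gf0 x : g (f x) = 0.
  have : range f (f x) by exists x.
  by rewrite exfg.
have [|h hP] := projP _ _ (to_ker gf0 : {linear A -> ker_type g})
  (to_ker gu0 : {linear P -> ker_type g}).
  rewrite eqEsubset; split=> // y _.
  have : range f (val y) by rewrite exfg; exact/eqP/(ker_valP y).
  by case=> x _ fx; exists x => //; exact: val_inj.
by exists h => x; have /(congr1 val) := hP x.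
Qed.

(** The linear map R^n -> M given by a family of n elements of M; vectors are
    rows. *)
Definition lincomb (M : lmodType R) n (a : 'I_n -> M) (v : 'rV[R]_n) : M :=
  \sum_i v 0 i *: a i.

Lemma lincomb_linear (M : lmodType R) n (a : 'I_n -> M) : linear (lincomb a).
Proof.
move=> c u v; rewrite /lincomb scaler_sumr -big_split /=.
by apply: eq_bigr => i _; rewrite !mxE scalerDl scalerA.
Qed.

HB.instance Definition _ (M : lmodType R) n (a : 'I_n -> M) :=
  GRing.isLinear.Build R 'rV[R]_n M *:%R (lincomb a) (lincomb_linear a).

Lemma lincomb_delta (M : lmodType R) n (a : 'I_n -> M) i :
  lincomb a (delta_mx 0 i) = a i.
Proof.
rewrite /lincomb (bigD1 i) //= big1 => [|j ji]; rewrite mxE !eqxx ?(negPf ji).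
  by rewrite scale1r addr0.
by rewrite scale0r.
Qed.

Lemma lincomb_delta_map (M : lmodType R) n (u : {linear 'rV[R]_n -> M}) v :
  lincomb (fun i => u (delta_mx 0 i)) v = u v.
Proof.
rewrite {2}[v]row_sum_delta linear_sum; apply: eq_bigr => i _.
by rewrite linearZ.
Qed.

Lemma linear_lincomb (M M' : lmodType R) n (a : 'I_n -> M)
  (u : {linear M -> M'}) v : u (lincomb a v) = lincomb (u \o a) v.
Proof. by rewrite linear_sum; apply: eq_bigr => i _; rewrite linearZ. Qed.

Lemma lincomb_mulmx (M : lmodType R) n p (a : 'I_n -> M) (D : 'M[R]_(p, n)) v :
  lincomb a (v *m D) = lincomb (fun i => lincomb a (row i D)) v.
Proof.
rewrite mulmx_sum_row linear_sum; apply: eq_bigr => i _.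
by rewrite linearZ.
Qed.

Lemma free_projective n : projective_module ('rV[R]_n : lmodType R).
Proof.
move=> A B f u fT.
have pre i : exists x, f x = u (delta_mx 0 i).
  by have : range f (u (delta_mx 0 i)) by [rewrite fT]; case=> x _; exists x.
have [a aP] := choice pre.
exists (lincomb a) => v /=.
rewrite linear_lincomb -[RHS]lincomb_delta_map; apply: eq_bigr => i _ /=.
by rewrite aP.
Qed.

(** Dependent choice along the natural numbers, for a type family. *)
Lemma dep_choice (T : nat -> Type) (P : forall n, T n -> Prop)
    (Q : forall n, T n -> T n.+1 -> Prop) :
  (exists x, P 0%N x) ->
  (forall n x, P n x -> exists y, P n.+1 y /\ Q n x y) ->
  exists f : forall n, T n,
    (forall n, P n (f n)) /\ forall n, Q n (f n) (f n.+1).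
Proof.
move=> P0 PS.
pose s0 : {x | P 0%N x} := cid P0.
pose sS n (s : {x | P n x}) : {x | P n.+1 x} :=
  let c := cid (PS n _ (svalP s)) in exist _ (sval c) (svalP c).1.
pose F := nat_rect (fun n => {x | P n x}) s0 sS.
exists (fun n => sval (F n)); split=> n; first exact: svalP.
exact: (svalP (cid (PS n _ (svalP (F n))))).2.
Qed.

Section Comparison.
Variable M : lmodType R.
Implicit Types P Q : proj_resolution M.

(** The kernel of the map that leaves degree [n], the augmentation for
    [n = 0]. *)
Definition cycle P n : P n -> Prop :=
  match n with
  | 0%N => fun x => pr_aug P x = 0
  | n.+1 => fun x => pr_d P n x = 0
  end.

Lemma boundary_cycle P n x : cycle (pr_d P n x).
Proof.
case: n x => [|n] x /=.
  have : range (pr_d P 0%N) (pr_d P 0%N x) by exists x.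
  by rewrite pr_aug_exact.
have : range (pr_d P n.+1) (pr_d P n.+1 x) by exists x.
by rewrite pr_exact.
Qed.

Lemma cycle_lift P n (X : lmodType R) (u : {linear X -> P n}) :
  projective_module X -> (forall x, cycle (u x)) ->
  exists h : {linear X -> P n.+1}, forall x, pr_d P n (h x) = u x.
Proof.
move=> projX; case: n u => [|n] u uP.
  exact: projective_lift projX (pr_aug_exact P) uP.
exact: projective_lift projX (pr_exact P n) uP.
Qed.

Lemma chain_map_exists P Q :
  exists f : forall n, {linear P n -> Q n},
    (forall x, pr_aug Q (f 0%N x) = pr_aug P x) /\
    forall n x, pr_d Q n (f n.+1 x) = f n (pr_d P n x).
Proof.
(* A map that sends cycles to cycles can be lifted one degree further. *)
pose good n (f : {linear P n -> Q n}) :=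
  (forall x, cycle x -> cycle (f x)) /\
  match n return {linear P n -> Q n} -> Prop with
  | 0%N => fun f => forall x, pr_aug Q (f x) = pr_aug P x
  | n.+1 => fun=> True
  end f.
have [|n f [fP _]|f [fP fQ]] := @dep_choice (fun n => {linear P n -> Q n}) good
  (fun n f g => forall x, pr_d Q n (g x) = f (pr_d P n x)).
- have [f fE] := @pr_proj _ _ P 0%N _ _ (pr_aug Q) (pr_aug P) (pr_aug_surj Q).
  by exists f; split=> [x /=|x]; rewrite -[pr_aug Q _]/((pr_aug Q \o f) x) fE.
- have [x|g gE] := @cycle_lift Q n _ (f \o pr_d P n) (@pr_proj _ _ P n.+1).
    exact/fP/boundary_cycle.
  by exists g; split=> //; split=> //= x xP; rewrite gE /= xP linear0.
- by exists f; split=> //; exact: (fP 0%N).2.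
Qed.

(** A chain endomorphism over 0 is null-homotopic. *)
Lemma null_homotopy P (u : forall n, {linear P n -> P n}) :
  (forall x, pr_aug P (u 0%N x) = 0) ->
  (forall n x, pr_d P n (u n.+1 x) = u n (pr_d P n x)) ->
  exists h : forall n, {linear P n -> P n.+1},
    (forall x, u 0%N x = pr_d P 0%N (h 0%N x)) /\
    forall n x, u n.+1 x = pr_d P n.+1 (h n.+1 x) + h n (pr_d P n x).
Proof.
move=> u0 uS.
pose good n (h : {linear P n -> P n.+1}) :=
  (forall x, cycle x -> u n x = pr_d P n (h x)) /\
  match n return {linear P n -> P n.+1} -> Prop with
  | 0%N => fun h => forall x, u 0%N x = pr_d P 0%N (h x)
  | n.+1 => fun=> True
  end h.
have [|n h [hP _]|h [hP hQ]] :=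
  @dep_choice (fun n => {linear P n -> P n.+1}) good
  (fun n h h' => forall x, u n.+1 x = pr_d P n.+1 (h' x) + h (pr_d P n x)).
- have [x|h hE] := cycle_lift (u := u 0%N) (@pr_proj _ _ P 0%N).
    exact: u0.
  by exists h; split=> x.
(* [u - h d] maps into the cycles: on a boundary, [u] agrees with [d h]. *)
- have [x|h' hE] :=
    cycle_lift (u := u n.+1 \- (h \o pr_d P n)) (@pr_proj _ _ P n.+1).
    by rewrite /= linearB uS /= -hP ?subrr //; exact: boundary_cycle.
  exists h'; split; first split=> //= x xP.
    by rewrite hE /= xP linear0 subr0.
  by move=> x; rewrite hE /= subrK.
- by exists h; split=> //; exact: (hP 0%N).2.
Qed.

(** Two projective resolutions of the same module are homotopy equivalent. *)
Lemma comparison P Q :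
  exists (f : forall n, {linear P n -> Q n}) (g : forall n, {linear Q n -> P n})
    (h : forall n, {linear P n -> P n.+1}),
    [/\ forall n x, pr_d Q n (f n.+1 x) = f n (pr_d P n x),
        forall n x, pr_d P n (g n.+1 x) = g n (pr_d Q n x) &
        forall n x, x = g n.+1 (f n.+1 x) +
          (pr_d P n.+1 (h n.+1 x) + h n (pr_d P n x))].
Proof.
have [f [f0 fS]] := chain_map_exists P Q.
have [g [g0 gS]] := chain_map_exists Q P.
have [|n x|h [_ hS]] := @null_homotopy P (fun n => idfun \- (g n \o f n)).
- by move=> x; rewrite linearB /= g0 f0 subrr.
- by rewrite linearB /= gS fS.
- by exists f, g, h; split=> // n x; rewrite -hS /= addrC subrK.
Qed.

(** Vanishing of Ext can be tested on any projective resolution. *)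
Lemma Ext_zero_resolution P (N : lmodType R) j : Ext_zero j.+1 M N ->
  forall phi : {linear P j.+1 -> N},
    (forall x, phi (pr_d P j.+1 x) = 0) ->
    exists psi : {linear P j -> N}, forall x, phi x = psi (pr_d P j x).
Proof.
case=> Q QE phi phi0.
have [f [g [h [fS gS hS]]]] := comparison P Q.
have [|psi psiE] := QE (phi \o g j.+1).
  by move=> x /=; rewrite -gS phi0.
exists ((psi \o f j) \+ (phi \o h j)) => x /=.
rewrite {1}[x](hS j) !linearD /= phi0 add0r.
by rewrite -[phi (g _ _)]/((phi \o g j.+1) _) psiE /= fS.
Qed.

(** If [M] has finite projective dimension, every projective resolution is
    contractible in high degrees. *)
Lemma pd_le_contraction P l : pd_le M l ->
  exists h : forall n, {linear P n -> P n.+1}, forall n, (l <= n)%N ->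
    forall x, x = pr_d P n.+1 (h n.+1 x) + h n (pr_d P n x).
Proof.
case=> Q Q0; have [f [g [h [_ _ hS]]]] := comparison P Q.
exists h => n ln x; rewrite {1}[x](hS n).
by rewrite (Q0 n.+1 ln (f n.+1 x)) linear0 add0r.
Qed.

End Comparison.
End Modules.

Section Cokernel.
Variables (R : comNzRingType) (p q : nat) (D : 'M[R]_(p, q)).

(** The row space of [D]. *)
Definition im_pred : {pred 'rV[R]_q} := fun x => `[< exists w, x = w *m D >].

Lemma im_pred_zmod : zmod_closed im_pred.
Proof.
split=> [|x y]; rewrite !unfold_in /im_pred.
  by apply/asboolP; exists 0; rewrite mul0mx.
move=> /asboolP[u ->] /asboolP[v ->]; apply/asboolP; exists (u - v).
by rewrite mulmxBl.
Qed.

HB.instance Definition _ :=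
  GRing.isZmodClosed.Build 'rV[R]_q im_pred im_pred_zmod.

(** The cokernel of the map [v |-> v *m D]. *)
Definition coker := Quotient.quot im_pred.
HB.instance Definition _ := GRing.Zmodule.on coker.

Definition coker_pi (x : 'rV[R]_q) : coker :=
  (\pi_(Quotient.quot im_pred) x)%qT.

Lemma coker_pi_zmod : zmod_morphism coker_pi.
Proof. by move=> x y; rewrite /coker_pi raddfB. Qed.

HB.instance Definition _ :=
  GRing.isZmodMorphism.Build 'rV[R]_q coker coker_pi coker_pi_zmod.

Lemma coker_pi_eq x y : coker_pi x = coker_pi y <-> exists w, x - y = w *m D.
Proof.
rewrite /coker_pi; split.
  by move=> /eqP; rewrite -Quotient.idealrBE => /asboolP.
by move=> xy; apply/eqP; rewrite -Quotient.idealrBE; exact/asboolP.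
Qed.

Definition coker_repr (z : coker) : 'rV[R]_q :=
  repr (z : Quotient.quot im_pred).

Lemma coker_reprK : cancel coker_repr coker_pi.
Proof. by move=> z; rewrite /coker_pi /coker_repr reprK. Qed.

Definition coker_scale (a : R) (z : coker) : coker :=
  coker_pi (a *: coker_repr z).

Lemma coker_scale_pi a x : coker_scale a (coker_pi x) = coker_pi (a *: x).
Proof.
have /coker_pi_eq[w wE] := coker_reprK (coker_pi x).
by apply/coker_pi_eq; exists (a *: w); rewrite -scalerBr wE scalemxAl.
Qed.

Lemma coker_scaleA a b z :
  coker_scale a (coker_scale b z) = coker_scale (a * b) z.
Proof. by rewrite -[z]coker_reprK !coker_scale_pi scalerA. Qed.

Lemma coker_scale1 : left_id 1 coker_scale.
Proof. by move=> z; rewrite -[z]coker_reprK coker_scale_pi scale1r. Qed.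

Lemma coker_scaleDr : right_distributive coker_scale +%R.
Proof.
move=> a y z; rewrite -[y]coker_reprK -[z]coker_reprK -raddfD !coker_scale_pi.
by rewrite scalerDr raddfD.
Qed.

Lemma coker_scaleDl z : {morph coker_scale^~ z : a b / a + b}.
Proof.
by move=> a b; rewrite -[z]coker_reprK !coker_scale_pi scalerDl raddfD.
Qed.

HB.instance Definition _ := GRing.Zmodule_isLmodule.Build R coker
  coker_scaleA coker_scale1 coker_scaleDr coker_scaleDl.

Lemma coker_pi_scalable : scalable coker_pi.
Proof. by move=> a x; rewrite -coker_scale_pi. Qed.

HB.instance Definition _ :=
  GRing.isScalable.Build R 'rV[R]_q coker *:%R coker_pi coker_pi_scalable.

Lemma coker_pi_surj : range coker_pi = setT.
Proof.
rewrite eqEsubset; split=> // z _; exists (coker_repr z) => //.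
exact: coker_reprK.
Qed.

Lemma coker_pi0 v : coker_pi v = 0 <-> exists w, v = w *m D.
Proof. by rewrite -(raddf0 coker_pi) coker_pi_eq subr0. Qed.

End Cokernel.

(** * Linear algebra over a local ring *)

Section LinearAlgebra.
Variable R : comNzRingType.

(** The rows of [E] generate the kernel of [v |-> v *m D]. *)
Definition syzygy p q r (D : 'M[R]_(p, q)) (E : 'M[R]_(r, p)) :=
  forall v : 'rV_p, v *m D = 0 <-> exists w, v = w *m E.

Lemma syzygy_mul0 p q r (D : 'M[R]_(p, q)) (E : 'M[R]_(r, p)) :
  syzygy D E -> E *m D = 0.
Proof.
by move=> DE; apply/row_matrixP => i; rewrite row_mul row0; apply/DE;
  exists (delta_mx 0 i); rewrite rowE.
Qed.

(** A matrix all of whose rows lie in the row space of [E] factors through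
    [E]. *)
Lemma factor_rows p q r (D : 'M[R]_(p, q)) (E : 'M[R]_(r, q)) :
  (forall i, exists w, row i D = w *m E) -> exists X, D = X *m E.
Proof.
move=> DE; have [X XE] := choice DE.
by exists (\matrix_i X i); apply/row_matrixP => i; rewrite row_mul rowK.
Qed.

(** Submodules of a finite free module over a Noetherian ring are finitely
    generated. *)
Lemma noetherian_rows n (L : set 'rV[R]_n) : noetherian R ->
  L 0 -> (forall u v, L u -> L v -> L (u + v)) ->
  (forall a v, L v -> L (a *: v)) ->
  exists p (E : 'M[R]_(p, n)), forall v, L v <-> exists w, v = w *m E.
Proof.
move=> noeR; elim: n L => [|n IHn] L L0 LD LZ.
  exists 0%N, 0 => v; rewrite (thinmx0 v); split=> // _.
  by exists 0; rewrite mul0mx.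
rewrite -[n.+1]/(1 + n)%N in L L0 LD LZ *.
pose I : set R := [set x | exists2 v, L v & v 0 0 = x].
have idI : ideal I.
  split=> [|_ _ [u Lu <-] [v Lv <-]|a _ [v Lv <-]].
  - by exists 0; rewrite ?mxE.
  - by exists (u + v); rewrite ?mxE //; exact: LD.
  - by exists (a *: v); rewrite ?mxE //; exact: LZ.
have [s [a IE]] := noeR I idI.
(* Lift generators of the ideal of first coordinates, and adjoin generators of
   the vectors whose first coordinate is 0. *)
have aI i : exists v, L v /\ v 0 0 = a i.
  suff [v] : I (a i) by exists v.
  rewrite IE; exists (fun j => (j == i)%:R).
  rewrite (bigD1 i) //= big1 => [|j /negPf ji].
    by rewrite eqxx scale1r addr0.
  by rewrite ji scale0r.
have [V VP] := choice aI.
have [|u v|b u|p [E EP]] := IHn (fun u => L (row_mx 0 u)).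
- by rewrite row_mx0.
- by move=> Lu /(LD _ _ Lu); rewrite add_row_mx addr0.
- by move=> /(LZ b); rewrite scale_row_mx scaler0.
have LV (c : 'rV_s) : L (c *m \matrix_i V i).
  rewrite mulmx_sum_row; elim/big_ind: _ => // i _.
  by rewrite rowK; apply: LZ; case: (VP i).
exists (s + p)%N, (col_mx (\matrix_i V i) (row_mx 0 E)) => v; split.
  move=> Lv; have : I (v 0 0) by exists v.
  rewrite IE => -[c cE]; pose w := \row_i c i.
  have : L (v - w *m \matrix_i V i).
    by apply: LD => //; rewrite -scaleN1r; apply: LZ; exact: LV.
  set v' := v - _.
  have v'0 : lsubmx v' = 0.
    have l0 : lshift n (0 : 'I_1) = 0 by exact: val_inj.
    apply/rowP => j; rewrite ord1 !mxE l0 cE; apply/eqP.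
    rewrite subr_eq0; apply/eqP/eq_bigr => i _.
    by rewrite !mxE (VP i).2.
  rewrite -[v']hsubmxK v'0 => /EP[u uE].
  exists (row_mx w u); rewrite mul_row_col mul_mx_row mulmx0 -uE -v'0 hsubmxK.
  by rewrite /v' addrC subrK.
case=> w ->; rewrite -[w]hsubmxK mul_row_col; apply: LD; first exact: LV.
by rewrite mul_mx_row mulmx0; apply/EP; exists (rsubmx w).
Qed.

Variables (k : fieldType) (pi : {rmorphism R -> k}).

(** When [pi] is the residue map of a local ring, this says that the rows of
    [E] minimally generate their span. *)
Definition minimal_rows p q (E : 'M[R]_(p, q)) :=
  forall w : 'rV_p, w *m E = 0 -> map_mx pi w = 0.

Lemma minimal_syzygy p q r (D : 'M[R]_(p, q)) (E : 'M[R]_(r, p)) :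
  minimal_rows D -> syzygy D E -> map_mx pi E = 0.
Proof.
move=> minD /syzygy_mul0 ED0; apply/row_matrixP => i.
by rewrite -map_row row0; apply: minD; rewrite -row_mul ED0 row0.
Qed.

(** A linear map sends vectors with entries in the kernel of [pi] to such
    vectors. *)
Lemma linear_residue p q (u : {linear 'rV[R]_p -> 'rV[R]_q}) v :
  map_mx pi v = 0 -> map_mx pi (u v) = 0.
Proof.
move=> /rowP v0; rewrite -lincomb_delta_map; apply/rowP => j.
rewrite mxE summxE rmorph_sum mxE big1 // => i _.
by have := v0 i; rewrite !mxE rmorphM => ->; rewrite mul0r.
Qed.

Lemma residue_all0 q : (forall v : 'rV[R]_q, map_mx pi v = 0) -> q = 0%N.
Proof.
case: q => // q /(_ (delta_mx 0 0))/rowP/(_ 0).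
by rewrite !mxE !eqxx rmorph1 => /eqP; rewrite oner_eq0.
Qed.

Hypothesis pi_unit : forall x, pi x != 0 -> exists y, y * x = 1.

(** Nakayama's lemma, for the span of a finite family. *)
Lemma nakayama (M : lmodType R) n (a : 'I_n -> M) (C : 'M[R]_n) :
  map_mx pi C = 0 -> (forall i, a i = lincomb a (row i C)) -> forall i, a i = 0.
Proof.
(* [1 - C] kills the family, and its determinant is congruent to 1. *)
move=> C0 aC i; pose A := 1%:M - C.
have A0 w : lincomb a (w *m A) = 0.
  rewrite lincomb_mulmx; apply: big1 => j _.
  by rewrite !linearB /= -aC row1 lincomb_delta subrr.
have [|c cA] := @pi_unit (\det A).
  by rewrite -det_map_mx map_mxB C0 map_mx1 subr0 det1 oner_neq0.
have := A0 (c *: (row i (\adj A))).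
rewrite -scalemxAl -row_mul mul_adj_mx -scalemx1 !linearZ /= scalerA cA scale1r.
by rewrite row1 lincomb_delta.
Qed.

(** A finite family can be shortened, keeping its span, until all
    coefficients of its relations lie in the kernel of [pi]. *)
Lemma minimal_generators (M : lmodType R) n (a : 'I_n -> M) :
  exists p (b : 'I_p -> M), range (lincomb b) = range (lincomb a) /\
    forall v, lincomb b v = 0 -> map_mx pi v = 0.
Proof.
elim: n a => [|n IHn] a.
  by exists 0%N, a; split=> // v _; rewrite (thinmx0 v) map_mx0.
case: (pselect (forall v, lincomb a v = 0 -> map_mx pi v = 0)) => [mina|].
  by exists n.+1, a.
move=> /existsNP[v /not_implyP[av0 piv]].
have [i vi] : exists i, pi (v 0 i) != 0.
  apply: contrapT => /forallNP pi0; apply: piv; apply/rowP => i.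
  by have /negP := pi0 i; rewrite negbK !mxE => /eqP.
have [y yv] := pi_unit vi.
(* The generator [a i] is a combination of the others. *)
have [p [b [bE minb]]] := IHn (fun j => a (lift i j)).
exists p, b; split=> //; rewrite {}bE eqEsubset; split=> x [w _ <-].
  exists (\row_j if unlift i j is Some l then w 0 l else 0) => //.
  rewrite /lincomb (bigD1_ord i) //= mxE unlift_none scale0r add0r.
  by apply: eq_bigr => j _; rewrite mxE liftK.
exists (\row_j (w - (w 0 i * y) *: v) 0 (lift i j)) => //.
have -> : lincomb a w = lincomb a (w - (w 0 i * y) *: v).
  by rewrite linearB linearZ /= av0 scaler0 subr0.
rewrite [in RHS]/lincomb (bigD1_ord i) //= !mxE -mulrA yv mulr1 subrr scale0r.
by rewrite add0r; apply: eq_bigr => j _; rewrite !mxE.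
Qed.

(** The kernel of a linear map from a finite free module to any module has a
    minimal finite family of generators. *)
Lemma minimal_kernel (M : lmodType R) p (u : {linear 'rV[R]_p -> M}) :
  noetherian R -> exists r (E : 'M[R]_(r, p)),
    (forall v, u v = 0 <-> exists w, v = w *m E) /\ minimal_rows E.
Proof.
move=> noeR.
have [|v w|a v|s [E EP]] := @noetherian_rows p (fun v => u v = 0) noeR.
- by rewrite linear0.
- by move=> u0 v0; rewrite linearD u0 v0 addr0.
- by move=> u0; rewrite linearZ /= u0 scaler0.
have [r [b [bE minb]]] := minimal_generators (fun i => row i E).
have bw w : w *m (\matrix_i b i) = lincomb b w.
  by rewrite mulmx_sum_row; apply: eq_bigr => i _; rewrite rowK.
exists r, (\matrix_i b i); split=> [v|w]; last by rewrite bw; exact: minb.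
have -> : (exists w, v = w *m \matrix_i b i) <-> range (lincomb b) v.
  by split=> [[w ->]|[w _ <-]]; exists w; rewrite ?bw.
by rewrite bE EP; split=> [[w ->]|[w _ <-]]; exists w; rewrite ?mulmx_sum_row.
Qed.

(** * Free resolutions *)

Hypothesis noeR : noetherian R.

Lemma minimal_syzygy_exists p q (D : 'M[R]_(p, q)) :
  exists r : {r & 'M[R]_(r, p)}, syzygy D (tagged r) /\ minimal_rows (tagged r).
Proof.
have [r [E EP]] := minimal_kernel (mulmxr D) noeR.
by exists (Tagged (fun r => 'M[R]_(r, p)) E).
Qed.

(** A chosen matrix of minimal generators of the syzygies of [D], with its
    number of rows. *)
Definition next_mx p q (D : 'M[R]_(p, q)) :=
  sval (cid (minimal_syzygy_exists D)).

(** The ranks and the differentials of the resolution that starts with [D] and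
    takes minimal generators of the syzygies from then on. *)
Fixpoint res_rank p q (D : 'M[R]_(p, q)) (n : nat) : nat :=
  if n is n'.+1 then res_rank (tagged (next_mx D)) n' else q.

Fixpoint res_mx p q (D : 'M[R]_(p, q)) (n : nat) :
    'M[R]_(res_rank D n.+1, res_rank D n) :=
  if n is n'.+1 then res_mx (tagged (next_mx D)) n' else D.

Lemma res_mx_syzygy p q (D : 'M[R]_(p, q)) n :
  syzygy (res_mx D n) (res_mx D n.+1).
Proof.
elim: n p q D => [|n IHn] p q D; last exact: (IHn _ _ (tagged (next_mx D))).
exact: (svalP (cid (minimal_syzygy_exists D))).1.
Qed.

Lemma res_mx_minimal p q (D : 'M[R]_(p, q)) n :
  minimal_rows D -> minimal_rows (res_mx D n).
Proof.
elim: n p q D => [|n IHn] p q D minD //.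
exact/IHn/(svalP (cid (minimal_syzygy_exists D))).2.
Qed.

Lemma res_mx_residue p q (D : 'M[R]_(p, q)) n :
  map_mx pi D = 0 -> minimal_rows D -> map_mx pi (res_mx D n) = 0.
Proof.
case: n => // n D0 minD.
exact: minimal_syzygy (res_mx_minimal (n := n) minD) (@res_mx_syzygy _ _ D n).
Qed.

End LinearAlgebra.

Section FreeResolution.
Variables (R : comNzRingType) (M : lmodType R).
Variables (n : nat -> nat) (D : forall k, 'M[R]_(n k.+1, n k)).
Variable aug : {linear 'rV[R]_(n 0%N) -> M}.
Hypothesis D_syzygy : forall k, syzygy (D k) (D k.+1).
Hypothesis aug_surj : range aug = setT.
Hypothesis aug_kernel : forall v, aug v = 0 <-> exists w, v = w *m D 0%N.

Definition free_diff k : {linear 'rV[R]_(n k.+1) -> 'rV[R]_(n k)} :=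
  mulmxr (D k).

Lemma free_resolution_aug_exact : exact (free_diff 0) aug.
Proof.
rewrite /exact eqEsubset; split=> v.
  by case=> w _ <-; apply/aug_kernel; exists w.
by move=> /aug_kernel[w ->]; exists w.
Qed.

Lemma free_resolution_exact k : exact (free_diff k.+1) (free_diff k).
Proof.
rewrite /exact eqEsubset; split=> v.
  by case=> w _ <-; apply/D_syzygy; exists w.
by move=> /D_syzygy[w ->]; exists w.
Qed.

(** The resolution of [M] by the modules R^(n k). *)
Definition free_resolution : proj_resolution M :=
  ProjResolution (fun k => @free_projective R (n k)) aug_surj
    free_resolution_aug_exact free_resolution_exact.

End FreeResolution.

(** * Tensor products with free modules *)

Section Tensor.
Variables (R : comNzRingType) (N : lmodType R).

(** The tensor product of R^n and [N] is encoded as N^n, with [x] (x) [y] the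
    family of the [x_i y]. *)
Definition tens n (x : 'rV[R]_n) (y : N) : {ffun 'I_n -> N} :=
  [ffun i => x 0 i *: y].

Lemma tens_zmodl n y : zmod_morphism (tens (n := n) ^~ y).
Proof. by move=> u v; apply/ffunP => i; rewrite !ffunE !mxE scalerBl. Qed.

Lemma tens_zmodr n (x : 'rV[R]_n) : zmod_morphism (tens x).
Proof. by move=> u v; apply/ffunP => i; rewrite !ffunE scalerBr. Qed.

Lemma tens_scalel n y : scalable_for *:%R (tens (n := n) ^~ y).
Proof. by move=> a u; apply/ffunP => i; rewrite !ffunE !mxE scalerA. Qed.

Lemma tens_scaler n (x : 'rV[R]_n) : scalable_for *:%R (tens x).
Proof. by move=> a u; apply/ffunP => i; rewrite !ffunE !scalerA mulrC. Qed.

HB.instance Definition _ n := isBilinear.Build R 'rV[R]_n N {ffun 'I_n -> N}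
  *:%R *:%R (@tens n) (@tens_zmodl n) (@tens_zmodr n)
  (@tens_scalel n) (@tens_scaler n).

Section Universal.
Variables (n : nat) (W : lmodType R) (phi : {bilinear 'rV[R]_n -> N -> W}).

Definition tens_lift (w : {ffun 'I_n -> N}) : W :=
  \sum_i phi (delta_mx 0 i) (w i).

Lemma tens_lift_linear : linear tens_lift.
Proof.
move=> a u v; rewrite /tens_lift scaler_sumr -big_split /=.
by apply: eq_bigr => i _; rewrite !ffunE linearDr linearZr_LR.
Qed.

HB.instance Definition _ :=
  GRing.isLinear.Build R {ffun 'I_n -> N} W *:%R tens_lift tens_lift_linear.

Lemma tens_liftE x y : tens_lift (tens x y) = phi x y.
Proof.
rewrite {2}[x]row_sum_delta linear_sumlz; apply: eq_bigr => i _.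
by rewrite ffunE linearZr_LR linearZl_LR.
Qed.

End Universal.

Lemma tens_sum n (w : {ffun 'I_n -> N}) : w = \sum_i tens (delta_mx 0 i) (w i).
Proof.
apply/ffunP => j; rewrite sum_ffunE (bigD1 j) //= big1 => [|i ij].
  by rewrite addr0 ffunE mxE !eqxx scale1r.
by rewrite ffunE mxE eq_sym (negPf ij) andbF scale0r.
Qed.

Lemma tens_is_tensor n : is_tensor (@tens n).
Proof.
move=> W phi; exists (tens_lift phi); split=> [|h hE w].
  exact: tens_liftE.
rewrite [w]tens_sum !linear_sum; apply: eq_bigr => i _ /=.
by rewrite hE tens_liftE.
Qed.

(** The map N^p -> N^q induced by [v |-> v *m D]. *)
Definition tens_mx p q (D : 'M[R]_(p, q)) (w : {ffun 'I_p -> N}) :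
  {ffun 'I_q -> N} := [ffun l => \sum_j D j l *: w j].

Lemma tens_mx_linear p q (D : 'M[R]_(p, q)) : linear (tens_mx D).
Proof.
move=> a u v; apply/ffunP => l; rewrite !ffunE scaler_sumr -big_split /=.
by apply: eq_bigr => j _; rewrite !ffunE scalerDr !scalerA mulrC.
Qed.

HB.instance Definition _ p q (D : 'M[R]_(p, q)) := GRing.isLinear.Build R
  {ffun 'I_p -> N} {ffun 'I_q -> N} *:%R (tens_mx D) (tens_mx_linear D).

Lemma tens_mxE p q (D : 'M[R]_(p, q)) x y :
  tens_mx D (tens x y) = tens (x *m D) y.
Proof.
apply/ffunP => l; rewrite !ffunE mxE scaler_suml; apply: eq_bigr => j _.
by rewrite ffunE scalerA mulrC.
Qed.

Lemma tens_mxM p q r (A : 'M[R]_(p, q)) (B : 'M[R]_(q, r)) w :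
  tens_mx B (tens_mx A w) = tens_mx (A *m B) w.
Proof.
rewrite [w]tens_sum !linear_sum; apply: eq_bigr => i _.
by rewrite /= !tens_mxE mulmxA.
Qed.

End Tensor.

(** * Fiber product rings *)

(** Over a local ring, an element outside the kernel of a surjection onto a
    field is invertible. *)
Lemma local_unit (R : comNzRingType) (k : fieldType) (pi : {rmorphism R -> k})
    x :
  local_ring R -> range pi = setT -> pi x != 0 -> exists y, y * x = 1.
Proof.
move=> [_ [m [maxm unim]]] piT pix; apply: contrapT => /forallNP xN.
have kerm : m = [set z | pi z = 0].
  apply: unim; split=> [||J [J0 JD JM] J1 kerJ].
  - split=> [|u v|a u] /=; first exact: rmorph0.
      by rewrite rmorphD => -> ->; rewrite addr0.
    by rewrite rmorphM => ->; rewrite mulr0.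
  - by rewrite /= rmorph1 => /eqP; rewrite oner_eq0.
  - rewrite eqEsubset; split=> // u Ju /=; apply/eqP/negPn/negP => piu.
    have [v _ vE] : range pi (pi u)^-1 by rewrite piT.
    apply: J1; rewrite -[1](subrK (v * u)); apply: JD; last exact: JM.
    by apply: kerJ; rewrite /= rmorphB rmorph1 rmorphM vE mulVf // subrr.
(* Zorn's lemma yields a maximal ideal above [x]; the empty set is admitted in
   order to be the union of the empty chain. *)
pose P A := A = set0 \/ [/\ ideal A, ~ A 1 & A x].
have [F FP totF|A [PA maxA]] := @Zorn_bigcup R P.
  case: (pselect (exists X z, F X /\ X z)) => [[X [z [FX Xz]]]|F0]; last first.
    left; rewrite -subset0 => z [X FX Xz]; apply: F0; by exists X, z.
  have idF Y y : F Y -> Y y -> [/\ ideal Y, ~ Y 1 & Y x].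
    by move=> FY Yy; have [Y0|//] := FP _ FY; rewrite Y0 in Yy.
  right; have [[X0 _ _] _ Xx] := idF _ _ FX Xz.
  split; [split| |].
  - by exists X.
  - move=> u v [Y FY Yu] [Z FZ Zv].
    have [[_ YD _] _ _] := idF _ _ FY Yu; have [[_ ZD _] _ _] := idF _ _ FZ Zv.
    have [YZ|ZY] := totF _ _ FY FZ.
      by exists Z => //; apply: ZD => //; exact: YZ.
    by exists Y => //; apply: YD => //; exact: ZY.
  - move=> a u [Y FY Yu]; exists Y => //.
    by have [[_ _ YM] _ _] := idF _ _ FY Yu; exact: YM.
  - by case=> Y FY Y1; have [_ /(_ Y1)] := idF _ _ FY Y1.
  - by exists X.
have [A0|[idA A1 Ax]] := PA.
  apply: (maxA [set z | exists a, z = a * x]).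
    by rewrite A0; split=> // /(_ 0); apply; exists 0; rewrite mul0r.
  right; split.
  - split; first by exists 0; rewrite mul0r.
      by move=> _ _ [a ->] [b ->]; exists (a + b); rewrite mulrDl.
    by move=> a _ [b ->]; exists (a * b); rewrite mulrA.
  - by case=> y /esym; exact: xN.
  - by exists 1; rewrite mul1r.
have maximA : maximal_ideal A.
  split=> // J idJ J1 AJ; apply: contrapT => JA; apply: (maxA J).
    by split=> // JA'; apply: JA; rewrite eqEsubset.
  by right; split=> //; exact: AJ.
move: Ax; rewrite -(unim _ maximA) kerm /= => /eqP.
by rewrite (negPf pix).
Qed.

(** The maps of a local fiber product ring to its two factors and to the residue
    field. The ideals I and J of the decomposition of the maximal ideal are the
    kernels of [pT] and [pS]; the last field says that every element of the
    maximal ideal has a component in I. *)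
Record fiber_maps (R S T : comNzRingType) (k : fieldType)
    (pi : {rmorphism R -> k}) (pS : {rmorphism R -> S})
    (pT : {rmorphism R -> T}) :
  Prop := FiberMaps {
  fm_unit : forall x, pi x != 0 -> exists y, y * x = 1;
  fm_inj : forall x, pS x = 0 -> pT x = 0 -> x = 0;
  fm_kerT : exists2 y, y != 0 & pT y = 0;
  fm_kerS : exists2 z, z != 0 & pS z = 0;
  fm_split : forall x, pi x = 0 -> exists a, pS a = pS x /\ pT a = 0
}.

Lemma fiber_product_maps (R : comNzRingType) : fiber_product_ring R ->
  exists (S T : comNzRingType) (k : fieldType) (pi : {rmorphism R -> k})
    (pS : {rmorphism R -> S}) (pT : {rmorphism R -> T}), fiber_maps pi pS pT.
Proof.
move=> [locR [S [T [k [piS [piT [_ [rS rT] [nS nT] [f bijf]]]]]]]].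
pose pS : {rmorphism R -> S} := fst \o (val \o f).
pose pT : {rmorphism R -> T} := snd \o (val \o f).
pose pi : {rmorphism R -> k} := piS \o pS.
have lift s t : piS s = piT t -> exists x, pS x = s /\ pT x = t.
  move=> st; have fst : fiber_pred piS piT (s, t) by exact/eqP.
  have [g _ gK] := bijf.
  by exists (g (FiberProduct fst)); rewrite /pS /pT /= gK.
have compat x : piS (pS x) = piT (pT x) by exact/eqP/(fp_valP (f x)).
have nonzero_ker (A B : comNzRingType) (p : {rmorphism A -> B}) :
    ~ injective p -> exists2 a, a != 0 & p a = 0.
  move=> np; apply: contrapT => p0; apply: np => u v uv.
  apply/eqP; rewrite -subr_eq0; apply/negPn/negP => uv0; apply: p0.
  by exists (u - v) => //; rewrite rmorphB uv subrr.
exists S, T, k, pi, pS, pT; split.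
- move=> x; apply: local_unit => //; rewrite eqEsubset; split=> // c _.
  have [s _ sc] : range piS c by rewrite rS.
  have [t _ tc] : range piT c by rewrite rT.
  have [|y [ys _]] := lift s t; first by rewrite sc.
  by exists y => //; rewrite -sc -ys.
- move=> x Sx Tx; apply: (bij_inj bijf); apply: val_inj.
  by rewrite rmorph0 [LHS]surjective_pairing -[_.1]/(pS x) -[_.2]/(pT x) Sx Tx.
- have [s s0 ps] := nonzero_ker _ _ _ nS.
  have [|y [ys yt]] := lift s 0; first by rewrite ps rmorph0.
  by exists y => //; apply: contraNneq s0 => y0; rewrite -ys y0 rmorph0.
- have [t t0 pt] := nonzero_ker _ _ _ nT.
  have [|y [ys yt]] := lift 0 t; first by rewrite pt rmorph0.
  by exists y => //; apply: contraNneq t0 => y0; rewrite -yt y0 rmorph0.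
- move=> x pix; have [|a [aS aT]] := lift (pS x) 0; first by rewrite rmorph0.
  by exists a.
Qed.

(** * Projective dimension over a fiber product ring *)

Section FiberProductRing.
Variables (R S T : comNzRingType) (k : fieldType).
Variables (pi : {rmorphism R -> k}) (pS : {rmorphism R -> S}).
Variable pT : {rmorphism R -> T}.
Hypothesis fm : fiber_maps pi pS pT.
Hypothesis noeR : noetherian R.

Lemma fiber_mx_eq0 p q (X : 'M[R]_(p, q)) :
  map_mx pS X = 0 -> map_mx pT X = 0 -> X = 0.
Proof.
move=> /matrixP SX /matrixP TX; apply/matrixP => i j; rewrite mxE.
by apply: (fm_inj fm); [have := SX i j | have := TX i j]; rewrite !mxE.
Qed.

(** An exact sequence 0 -> R^p -> R^q -> R^r whose first map has entries in the
    maximal ideal forces p = 0. *)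
Lemma injective_syzygy_rank0 p q r (A : 'M[R]_(p, q)) (B : 'M[R]_(q, r)) :
  map_mx pi A = 0 -> syzygy B A -> (forall v : 'rV_p, v *m A = 0 -> v = 0) ->
  p = 0%N.
Proof.
move=> piA BA injA; have AB0 := syzygy_mul0 BA.
have mx_injA s (X : 'M_(s, p)) : X *m A = 0 -> X = 0.
  move=> XA; apply/row_matrixP => i; rewrite row0.
  by apply: injA; rewrite -row_mul XA row0.
have split_entry (ij : 'I_p * 'I_q) :
    exists a, pS a = pS (A ij.1 ij.2) /\ pT a = 0.
  by apply: (fm_split fm); move/matrixP/(_ ij.1 ij.2): piA; rewrite !mxE.
have [a aP] := choice split_entry.
(* [AI] is the component of [A] in I, that is, in the kernel of [pT]. *)
pose AI := \matrix_(i, j) a (i, j).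
have SAI : map_mx pS AI = map_mx pS A.
  by apply/matrixP => i j; rewrite !mxE (aP (i, j)).1.
have TAI : map_mx pT AI = 0 by apply/matrixP => i j; rewrite !mxE (aP (i, j)).2.
have AIB : AI *m B = 0.
  apply: fiber_mx_eq0; rewrite map_mxM ?TAI ?mul0mx //.
  by rewrite SAI -map_mxM AB0 map_mx0.
(* Exactness makes the rows of [AI] combinations of the rows of [A]. *)
have [U UE] : exists U, AI = U *m A.
  by apply: factor_rows => i; apply/BA; rewrite -row_mul AIB row0.
have [y y0 Ty] := fm_kerT fm; have [z z0 Sz] := fm_kerS fm.
have zU : z *: U = 0.
  apply: mx_injA; rewrite -scalemxAl -UE; apply: fiber_mx_eq0; rewrite map_mxZ.
    by rewrite Sz scale0r.
  by rewrite TAI scaler0.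
have yU : y *: (1%:M - U) = 0.
  apply: mx_injA; rewrite -scalemxAl mulmxBl mul1mx -UE.
  apply: fiber_mx_eq0; rewrite map_mxZ map_mxB.
    by rewrite SAI subrr scaler0.
  by rewrite Ty scale0r.
(* A diagonal entry of [U] is neither a unit nor congruent to 0. *)
case: p A piA BA injA AB0 mx_injA split_entry a aP AI SAI TAI AIB U UE zU yU =>
  // p A _ _ _ _ _ _ a _ AI _ _ _ U _ /matrixP/(_ 0 0) zU /matrixP/(_ 0 0) yU.
rewrite !mxE in zU yU; rewrite eqxx /= in yU.
have [piU|/(fm_unit fm)[w wU]] := eqVneq (pi (U 0 0)) 0.
  have [|w wU] := fm_unit fm (x := 1 - U 0 0).
    by rewrite rmorphB rmorph1 piU subr0 oner_eq0.
  by case/eqP: y0; rewrite -[y]mulr1 -wU mulrCA yU mulr0.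
by case/eqP: z0; rewrite -[z]mulr1 -wU mulrCA zU mulr0.
Qed.

Section MinimalResolution.
Variables (M : lmodType R) (n : nat -> nat).
Variable D : forall i, 'M[R]_(n i.+1, n i).
Variable aug : {linear 'rV[R]_(n 0%N) -> M}.
Hypothesis D_syzygy : forall i, syzygy (D i) (D i.+1).
Hypothesis aug_surj : range aug = setT.
Hypothesis aug_kernel : forall v, aug v = 0 <-> exists w, v = w *m D 0%N.
Hypothesis D_residue : forall i, map_mx pi (D i) = 0.

(** If one module of the minimal resolution of degree at least 2 vanishes, so
    do those below it, down to degree 2. *)
Lemma minimal_rank_descent i : n i.+2 = 0%N -> n 2%N = 0%N.
Proof.
elim: i => // i IHi ni; apply: IHi.
apply: (injective_syzygy_rank0 (D_residue i.+1) (@D_syzygy i)).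
move=> v /D_syzygy[w ->].
by move: w (D i.+2); rewrite ni => w E; rewrite (thinmx0 w) mul0mx.
Qed.

(** Finite projective dimension makes the minimal resolution vanish in degree
    2. *)
Lemma finite_pd_rank2 l : pd_le M l -> n 2%N = 0%N.
Proof.
move=> pdM; pose P := free_resolution D_syzygy aug_surj aug_kernel.
have [h hP] := pd_le_contraction P pdM.
apply: (@minimal_rank_descent l); apply: (residue_all0 (pi := pi)) => v.
rewrite [v](hP l.+1 (leqnSn l) v) map_mxD.
have -> : map_mx pi (pr_d P l.+2 (h l.+2 v)) = 0.
  by rewrite map_mxM D_residue mulmx0.
rewrite add0r; apply: (@linear_residue R k pi _ _ (h l.+1)).
by rewrite map_mxM D_residue mulmx0.
Qed.

Lemma rank2_pd_le1 : n 2%N = 0%N -> pd_le M 1.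
Proof.
move=> n2; exists (free_resolution D_syzygy aug_surj aug_kernel) => i i1 v.
have ni : n i = 0%N.
  case: i i1 {v} => [|[|i]] // _; elim: i => // i IHi.
  apply: (residue_all0 (pi := pi)) => v.
  have /D_syzygy[w ->] : v *m D i.+2 = 0.
    by move: (D i.+2); rewrite IHi => E; exact: thinmx0.
  by rewrite map_mxM D_residue mulmx0.
by move: v => /=; rewrite ni => v; exact: thinmx0.
Qed.

(** Ext^(j+1)(M, N) = 0, in terms of the transposed matrices: Hom(R^n, N) is
    identified with the tensor product of R^n and N. *)
Lemma Ext_zero_tens_mx (N : lmodType R) j : Ext_zero j.+1 M N ->
  forall w : {ffun 'I_(n j.+1) -> N}, tens_mx (D j.+1)^T w = 0 ->
    exists u, w = tens_mx (D j)^T u.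
Proof.
move=> ext w /ffunP w0; pose P := free_resolution D_syzygy aug_surj aug_kernel.
have [|psi psiE] := Ext_zero_resolution (P := P) ext (phi := lincomb w).
  move=> v; rewrite /= lincomb_mulmx; apply: big1 => i _.
  have := w0 i; rewrite !ffunE; under eq_bigr do rewrite mxE.
  by rewrite /lincomb; under [in X in _ -> X]eq_bigr do rewrite mxE; move=> ->;
    rewrite scaler0.
exists [ffun l => psi (delta_mx 0 l)]; apply/ffunP => i.
rewrite ffunE -[LHS](lincomb_delta w) psiE /= -rowE -lincomb_delta_map.
by apply: eq_bigr => l _; rewrite !mxE ffunE.
Qed.

End MinimalResolution.

(** Finitely generated modules have minimal free resolutions. *)
Lemma minimal_resolution (M : lmodType R) : finitely_generated M ->
  exists (n : nat -> nat) (D : forall i, 'M[R]_(n i.+1, n i))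
    (aug : {linear 'rV[R]_(n 0%N) -> M}),
    [/\ forall i, syzygy (D i) (D i.+1), range aug = setT,
        forall v, aug v = 0 <-> exists w, v = w *m D 0%N &
        forall i, map_mx pi (D i) = 0].
Proof.
move=> [s [a aT]]; have pu := fm_unit fm.
have [p [b [bE minb]]] := minimal_generators pu a.
have [r [E [EP minE]]] := minimal_kernel pu (lincomb b) noeR.
have E0 : map_mx pi E = 0.
  apply/row_matrixP => i; rewrite -map_row row0; apply: minb; apply/EP.
  by exists (delta_mx 0 i); rewrite rowE.
exists (res_rank pu noeR E), (res_mx pu noeR E), (lincomb b); split=> //.
- exact: res_mx_syzygy.
- rewrite bE eqEsubset; split=> // x _.
  have : lin_span a x by rewrite aT.
  by case=> c ->; exists (\row_i c i) => //; apply: eq_bigr => i _; rewrite mxE.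
- by move=> i; exact: res_mx_residue.
Qed.

(** If the cokernel of [D] has finite projective dimension, the row space of
    [D] is free: the rows of [E] are a basis. *)
Lemma finite_pd_coker p q (D : 'M[R]_(p, q)) l :
  map_mx pi D = 0 -> pd_le (coker D) l ->
  exists r (E : 'M[R]_(r, q)) X Y, [/\ D = X *m E, E = Y *m D &
    forall s (V : 'M_(s, r)), V *m E = 0 -> V = 0].
Proof.
move=> D0 pdD; have pu := fm_unit fm.
have [r [b [bE minb]]] := minimal_generators pu (fun i => row i D).
have rowsD (v : 'rV_q) :
    range (lincomb (fun i => row i D)) v <-> exists w, v = w *m D.
  by split=> [[w _ <-]|[w ->]]; exists w => //; rewrite mulmx_sum_row.
pose E := \matrix_i b i.
have Eb w : w *m E = lincomb b w.
  by rewrite mulmx_sum_row; apply: eq_bigr => i _; rewrite rowK.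
have rowsE (v : 'rV_q) : (exists w, v = w *m D) <-> exists w, v = w *m E.
  by rewrite -rowsD -bE; split=> [[w _ <-]|[w ->]]; exists w; rewrite ?Eb.
have [X XE] : exists X, D = X *m E.
  by apply: factor_rows => i; apply/rowsE; exists (delta_mx 0 i); rewrite rowE.
have [Y YE] : exists Y, E = Y *m D.
  by apply: factor_rows => i; apply/rowsE; exists (delta_mx 0 i); rewrite rowE.
have minE : minimal_rows pi E by move=> w; rewrite Eb; exact: minb.
have E0 : map_mx pi E = 0 by rewrite YE map_mxM D0 mulmx0.
have kerE (v : 'rV_q) : coker_pi D v = 0 <-> exists w, v = w *m E.
  by rewrite coker_pi0 rowsE.
have n2 := finite_pd_rank2 (@res_mx_syzygy _ _ _ pu noeR _ _ E)
  (coker_pi_surj D) kerE (fun i => res_mx_residue pu noeR i E0 minE) pdD.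
exists r, E, X, Y; split=> // s V VE; apply/row_matrixP => i; rewrite row0.
have /(@res_mx_syzygy _ _ _ pu noeR _ _ E 0)[w ->] : row i V *m E = 0.
  by rewrite -row_mul VE row0.
by move: w (res_mx _ _ _ _); rewrite n2 => w F; rewrite (thinmx0 w) mul0mx.
Qed.

(** Tor_1(coker D, N) vanishes once the cycles of degree 1 come from matrices
    [V] with [V *m D = 0]. *)
Lemma Tor1_zero_coker p q (D : 'M[R]_(p, q)) (N : lmodType R) :
  (forall w : {ffun 'I_p -> N}, tens_mx D w = 0 ->
    exists r (V : 'M[R]_(r, p)) u, V *m D = 0 /\ w = tens_mx V u) ->
  Tor_zero 1 (coker D) N.
Proof.
move=> cyc; have pu := fm_unit fm.
pose F := res_mx pu noeR D; have Fsyz := @res_mx_syzygy _ _ _ pu noeR _ _ D.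
exists (free_resolution Fsyz (coker_pi_surj D) (@coker_pi0 _ _ _ D)).
exists (fun i => {ffun 'I_(res_rank pu noeR D i) -> N}).
exists (fun i => @tens R N _), (fun i => tens_mx (F i)).
split=> [i|i x y|]; first exact: tens_is_tensor.
  exact: tens_mxE.
rewrite /exact eqEsubset; split=> w /=.
  case=> u _ <-; rewrite tens_mxM (syzygy_mul0 (Fsyz 0%N)).
  by apply/ffunP => i; rewrite !ffunE big1 // => j _; rewrite mxE scale0r.
move=> /cyc[r [V [u [VD ->]]]].
have [W ->] : exists W, V = W *m F 1%N.
  apply: factor_rows => i; apply/(Fsyz 0%N).
  by rewrite -row_mul [_ *m _]VD row0.
by exists (tens_mx W u); rewrite ?tens_mxM.
Qed.

(** A nonzero finitely generated module differs from its product by the maximal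
    ideal. *)
Lemma nakayama_module (N : lmodType R) :
  finitely_generated N -> ~ zero_module N ->
  exists y : N, forall q (c : 'rV[R]_q) u, map_mx pi c = 0 -> y <> lincomb u c.
Proof.
move=> [s [a aT]] N0; apply: contrapT => /forallNP mN; apply: N0.
have span x : exists v, x = lincomb a v.
  have [c ->] : lin_span a x by rewrite aT.
  by exists (\row_i c i); apply: eq_bigr => i _; rewrite mxE.
have gen i : exists v, map_mx pi v = 0 /\ a i = lincomb a v.
  have /existsNP[q /existsNP[c /existsNP[u]]] := mN (a i).
  move=> /not_implyP[c0 /contrapT aE].
  have [B BE] := choice (fun l => span (u l)).
  exists (c *m \matrix_l B l); rewrite map_mxM c0 mul0mx; split=> //.
  by rewrite aE lincomb_mulmx; apply: eq_bigr => l _; rewrite rowK BE.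
have [C CE] := choice gen.
have a0 : forall i, a i = 0.
  apply: (nakayama (pi := pi) (fm_unit fm) (C := \matrix_i C i)) => [|i].
    by apply/row_matrixP => i; rewrite -map_row rowK row0 (CE i).1.
  by rewrite rowK (CE i).2.
by move=> x; have [v ->] := span x; apply: big1 => i _; rewrite a0 scaler0.
Qed.

(** An idempotent matrix with entries in the maximal ideal is zero. *)
Lemma idempotent_residue0 p (e : 'M[R]_p) :
  map_mx pi e = 0 -> e *m e = e -> e = 0.
Proof.
move=> e0 ee; apply/row_matrixP => i; rewrite row0.
apply: (nakayama (fm_unit fm) e0 (a := fun i => row i e)) => j.
by rewrite -{1}ee row_mul mulmx_sum_row.
Qed.

Lemma rigid_test_pd_le1 (M N : lmodType R) j :
  finitely_generated M -> ~ zero_module N -> rigid_test N ->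
  Ext_zero j.+2 M N -> pd_le M 1.
Proof.
move=> fgM N0 [fgN rigN] extMN.
have [n [D [aug [Dsyz augT augK D0]]]] := minimal_resolution fgM.
apply: (rank2_pd_le1 Dsyz augT augK D0).
apply: (@minimal_rank_descent _ _ Dsyz D0 j).
have cochain := Ext_zero_tens_mx Dsyz augT augK extMN.
have DD : (D j.+1)^T *m (D j.+2)^T = 0.
  by rewrite -trmx_mul (syzygy_mul0 (Dsyz j.+1)) trmx0.
set d := (D j.+2)^T in cochain DD.
have d0 : map_mx pi d = 0 by rewrite -map_trmx D0 trmx0.
have fgZ : finitely_generated (coker d).
  exists (n j.+3), (fun i => coker_pi d (delta_mx 0 i)).
  rewrite eqEsubset; split=> // z _.
  have [v _ <-] : range (coker_pi d) z by rewrite coker_pi_surj.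
  exists (v 0); exact/esym/(lincomb_delta_map (coker_pi d)).
have [|_ [l pdZ]] := rigN _ fgZ 1%N isT.
  apply: Tor1_zero_coker => w /cochain[u ->].
  by exists (n j.+1), (D j.+1)^T, u.
have [r [E [X [Y [dE Ed injE]]]]] := finite_pd_coker d0 pdZ.
have YX : Y *m X = 1%:M.
  apply/eqP; rewrite -subr_eq0; apply/eqP/injE.
  by rewrite mulmxBl -mulmxA -dE -Ed mul1mx subrr.
(* The idempotent [e] projects onto the kernel of [d]. *)
pose e := 1%:M - X *m Y.
have eX : e *m X = 0 by rewrite mulmxBl mul1mx -mulmxA YX mulmx1 subrr.
have ee : e *m e = e by rewrite {2}/e mulmxBr mulmx1 mulmxA eX mul0mx subr0.
have [y yN] := nakayama_module fgN N0.
have e0 : map_mx pi e = 0.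
  apply/matrixP => a b; rewrite [LHS]mxE [RHS]mxE.
  apply/eqP/negPn/negP => /(fm_unit fm)[x xe].
  have [|u /ffunP/(_ b)] := cochain (tens (row a e) y).
    by rewrite tens_mxE -row_mul dE mulmxA eX mul0mx row0;
      apply/ffunP => i; rewrite !ffunE mxE scale0r.
  rewrite !ffunE mxE => ey; apply: (yN _ (x *: row b (D j.+1)) u).
    by rewrite map_mxZ map_row D0 row0 scaler0.
  rewrite linearZ /= -[LHS]scale1r -xe -scalerA ey; congr (_ *: _).
  by apply: eq_bigr => i _; rewrite !mxE.
have XY : X *m Y = 1%:M.
  by apply/esym/eqP; rewrite -subr_eq0; apply/eqP/idempotent_residue0.
(* [d] is injective on rows, and its composite with the transpose of [D j.+1]
   is 0. *)
have Dj0 : D j.+1 = 0.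
  apply: trmx_inj; rewrite trmx0 -[LHS]mulmx1 -XY mulmxA.
  suff -> : (D j.+1)^T *m X = 0 by rewrite mul0mx.
  by apply: injE; rewrite -mulmxA -dE.
apply: (residue_all0 (pi := pi)) => v.
have /Dsyz[w ->] : v *m D j.+1 = 0 by rewrite Dj0 mulmx0.
by rewrite map_mxM D0 mulmx0.
Qed.

End FiberProductRing.

Theorem corollary3p24 (R : comNzRingType) (M N : lmodType R) (i : nat) :
  gorenstein R -> fiber_product_ring R ->
  finitely_generated M -> finitely_generated N ->
  ~ zero_module M -> ~ zero_module N ->
  rigid_test N ->
  (1 < i)%N -> Ext_zero i M N ->
  pd_le M 1.
Proof.
move=> _ fpR fgM _ _ N0 rigN; case: i => [|[|j]] // _ ext.
have [[noeR _] _] := fpR.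
have [S [T [k [pi [pS [pT fm]]]]]] := fiber_product_maps fpR.
exact: (rigid_test_pd_le1 fm noeR fgM N0 rigN ext).
Qed.
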